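(* Let $\mathcal H,\mathcal G$, $L$, $A$, $B$, $C$, $D$, $\mathbf Z$ be as in the Problem described in the context, let the Assumption (i)–(v) of the context hold, and let $\mathbf H=\mathcal H\times\mathcal G$ and $\mathbf A,\mathbf C,\mathbb S$ be as defined in the context. Let $(\tau,\sigma)\in\,]0,+\infty[^2$, let $\mathbf S:\mathbf H\to\mathbf H$ be a bounded linear, self-adjoint and strongly monotone operator, and suppose that there are $(\underline\chi,\overline\chi)\in\,]0,+\infty[^2$ with $$(\forall(z,v)\in\mathbf H)\quad\underline\chi\|(z,v)\|_{\mathbf S}^2\le\|z\|^2+\frac\tau\sigma\|v\|^2\quad\text{and}\quad\|z\|^2+\frac\sigma\tau\|v\|^2\le\overline\chi\|(z,v)\|_{\mathbf S^{-1}}^2.$$ Define $\hat\mu=\min\{\nu_A,\sigma\nu_B/\tau\}$ and $$\hat\rho=\begin{cases}\min\{0,\rho_{A,B},\frac\tau\sigma\mu_{A,B}\},&\text{if }\min\{\rho_A+\rho_B,\mu_A+\mu_B\}>0\\ \min\{0,\frac\tau\sigma\mu_{A,B}\},&\text{if }\rho_A=\rho_B=0\text{ and }\mu_A+\mu_B>0\\ \min\{0,\rho_{A,B}\},&\text{if }\mu_A=\mu_B=0\text{ and }\rho_A+\rho_B>0\\ 0,&\text{if }\mu_A=\mu_B=\rho_A=\rho_B=0\end{cases}$$ with $\rho_{A,B}=\rho_A\rho_B/(\rho_A+\rho_B)$ if $\rho_A+\rho_B>0$ and $\mu_{A,B}=\mu_A\mu_B/(\mu_A+\mu_B)$ if $\mu_A+\mu_B>0$.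 Then $\mathbf A$ is $(\underline\chi\hat\mu\,\mathbf S,\overline\chi\hat\rho\,\mathbf S^{-1})$-semimonotone on $\mathbb S$.
   Context: Problem. $\mathcal H,\mathcal G$ are real Hilbert spaces, $L:\mathcal H\to\mathcal G$ is bounded linear with adjoint $L^*$, $A:\mathcal H\to2^{\mathcal H}$ and $B:\mathcal G\to2^{\mathcal G}$ are set-valued, $C:\mathcal H\to\mathcal H$ is $\beta$-cocoercive ($\langle x-y,Cx-Cy\rangle\ge\beta\|Cx-Cy\|^2$) with $\beta>0$, $D:\mathcal H\to\mathcal H$ is $\vartheta$-Lipschitzian with $\vartheta\ge0$. The solution set $\mathbf Z$ is the set of $(x,u)\in\mathcal H\times\mathcal G$ with $0\in(A+C+D)x+L^*u$ and $u\in BLx$; it is assumed nonempty. Semimonotonicity. For bounded self-adjoint linear $M,N$ and a set $\mathcal S$ of pairs, a set-valued operator $E$ is $(M,N)$-semimonotone on $\mathcal S$ if $\langle x-y,u-v\rangle\ge\langle x-y,M(x-y)\rangle+\langle u-v,N(u-v)\rangle$ for all $(y,v)\in\mathcal S$ and $(x,u)\in\operatorname{gra}E$. A scalar in place of $M$ or $N$ denotes that multiple of the identity. $J_E=(\mathrm{Id}+E)^{-1}$. $\|x\|_{\mathbf S}^2=\langle x,\mathbf Sx\rangle$; strongly monotone means $\langle\mathbf Sx,x\rangle\ge m\|x\|^2$ for some $m>0$. On $\mathbf H=\mathcal H\times\mathcal G$: $\mathbf A(z,v)=\big((A+D)z+L^*v\big)\times\big(B^{-1}v-Lz\big)$, $\mathbf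 C(z,v)=(Cz,0)$, and $\mathbb S=\{(x^*,-\mathbf Cx^* ):x^*\in\operatorname{zer}(\mathbf A+\mathbf C)\}$ (note $\operatorname{zer}(\mathbf A+\mathbf C)=\mathbf Z$). Assumption. $(\mu_A,\mu_B,\rho_A,\rho_B)\in\mathbb R^4$, $(\nu_A,\nu_B)\in[0,+\infty[^2$, and (i) $\rho_A+\rho_B\ge0$, $\mu_A+\mu_B\ge0$, ($\rho_A+\rho_B=0\Rightarrow\rho_A=\rho_B=0$), ($\mu_A+\mu_B=0\Rightarrow\mu_A=\mu_B=0$); (ii) $A+D$ is $(\nu_A\mathrm{Id}+\mu_AL^*L,\rho_A)$-semimonotone on $\{(x^*,-Cx^*-L^*u^* ):(x^*,u^* )\in\mathbf Z\}$; (iii) $B$ is $(\mu_B,\nu_B\mathrm{Id}+\rho_BLL^* )$-semimonotone on $\{(Lx^*,u^* ):(x^*,u^* )\in\mathbf Z\}$; (iv) there exist nonempty sets $\Omega_A,\Omega_B\subset\,]0,+\infty[$ such that, for every $(\tau,\sigma)\in\Omega_A\times\Omega_B$, $J_{\tau A}$ and $J_{\sigma B^{-1}}$ are single-valued with full domain; (v) $\operatorname{gra}(\mathbf A+\mathbf C)$ is sequentially weak-strong closed ($x_n\rightharpoonup x$, $u_n\to u$, $(x_n,u_n)$ in the graph imply $(x,u)$ in the graph). *)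

(* Defs.v *)
From HB Require Import structures.
From mathcomp Require Import all_boot all_order all_algebra.
From mathcomp Require Import all_classical all_reals all_analysis.
From mathcomp Require Import ring lra.

Set Implicit Arguments.
Unset Strict Implicit.
Unset Printing Implicit Defensive.

Import Order.TTheory GRing.Theory Num.Theory.
Import numFieldNormedType.Exports.

Local Open Scope classical_set_scope.
Local Open Scope ring_scope.

HB.mixin Record CompleteNormedModule_isHilbert (R : realType) V
    & CompleteNormedModule R V := {
  inner : V -> V -> R;
  innerC : forall x y, inner x y = inner y x;
  innerDl : forall x y z, inner (x + y) z = inner x z + inner y z;
  innerZl : forall (a : R) x y, inner (a *: x) y = a * inner x y;
  inner_norm : forall x, inner x x = `|x| ^+ 2
}.

#[short(type="hilbertType")]
HB.structure Definition Hilbert (R : realType) :=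
  {V of CompleteNormedModule_isHilbert R V & CompleteNormedModule R V}.

Section inner_theory.
Context {R : realType} {V : hilbertType R}.
Implicit Types x y z : V.

Lemma innerDr x y z : inner z (x + y) = inner z x + inner z y.
Proof. by rewrite innerC innerDl !(innerC z). Qed.

Lemma innerZr (a : R) x y : inner x (a *: y) = a * inner x y.
Proof. by rewrite innerC innerZl innerC. Qed.

Lemma innerBl x y z : inner (x - y) z = inner x z - inner y z.
Proof. by rewrite innerDl -scaleN1r innerZl mulN1r. Qed.

Lemma inner_CauchySchwarz x y : `|inner x y| <= `|x| * `|y|.
Proof.
have [->|y0] := eqVneq y 0.
  have -> : inner x 0 = 0 by rewrite -(scale0r 0) innerZr mul0r.
  by rewrite !normr0 mulr0.
rewrite -(@ler_pXn2r _ 2)// ?nnegrE ?mulr_ge0//.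
rewrite exprMn -normrX ger0_norm ?sqr_ge0// -!inner_norm.
set a := inner x y; set b := inner y y; set c := inner x x.
have b_gt0 : 0 < b by rewrite /b inner_norm exprn_gt0// normr_gt0.
have : 0 <= inner (b *: x + (- a) *: y) (b *: x + (- a) *: y).
  by rewrite inner_norm sqr_ge0.
rewrite !(innerDl, innerDr, innerZl, innerZr) -/c (innerC y x) -/a -/b.
move=> h; rewrite -(ler_pM2l b_gt0); nra.
Qed.

End inner_theory.

(* H * G already carries the supremum norm; the alias [hsum H G] carries the
   inner product <x1, y1> + <x2, y2> and the norm it induces. *)
Definition hsum {R : realType} (H G : hilbertType R) : Type := (H * G)%type.

Section hilbert_sum.
Context {R : realType} {H G : hilbertType R}.

HB.instance Definition _ := GRing.Lmodule.copy (hsum H G) (H * G)%type.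

Definition hsum_inner (p q : hsum H G) : R := inner p.1 q.1 + inner p.2 q.2.

Definition hsum_norm (p : hsum H G) : R :=
  Num.sqrt (`|p.1| ^+ 2 + `|p.2| ^+ 2).

Let hsum_sqr_norm p : hsum_norm p ^+ 2 = hsum_inner p p.
Proof. by rewrite sqr_sqrtr ?addr_ge0 ?sqr_ge0// /hsum_inner !inner_norm. Qed.

Let hsum_norm_ge0 p : 0 <= hsum_norm p.
Proof. exact: sqrtr_ge0. Qed.

Let hsum_innerC p q : hsum_inner p q = hsum_inner q p.
Proof. by rewrite /hsum_inner innerC (innerC p.2). Qed.

Let hsum_innerDl p q r :
  hsum_inner (p + q) r = hsum_inner p r + hsum_inner q r.
Proof. by rewrite /hsum_inner /= !innerDl addrACA. Qed.

Let hsum_innerZl (a : R) p q : hsum_inner (a *: p) q = a * hsum_inner p q.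
Proof. by rewrite /hsum_inner /= !innerZl mulrDr. Qed.

Let hsum_ler_normD p q : hsum_norm (p + q) <= hsum_norm p + hsum_norm q.
Proof.
rewrite -(@ler_pXn2r _ 2)// ?nnegrE ?addr_ge0// sqrrD !hsum_sqr_norm.
rewrite hsum_innerDl !(hsum_innerC _ (p + q)) !hsum_innerDl (hsum_innerC q p).
suff : hsum_inner p q <= hsum_norm p * hsum_norm q by lra.
rewrite -sqrtrM ?addr_ge0 ?sqr_ge0//.
set a := `|p.1|; set b := `|p.2|; set c := `|q.1|; set d := `|q.2|.
apply: (@le_trans _ _ (a * c + b * d)).
  apply: lerD; apply: (le_trans (ler_norm _)); exact: inner_CauchySchwarz.
have acbd0 : 0 <= a * c + b * d.
  by apply: addr_ge0; apply: mulr_ge0; exact: normr_ge0.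
rewrite -[leLHS]ger0_norm// -sqrtr_sqr ler_sqrt; last first.
  by rewrite mulr_ge0 ?addr_ge0 ?sqr_ge0.
have := sqr_ge0 (a * d - b * c); nra.
Qed.

Let hsum_normrZ (l : R) p : hsum_norm (l *: p) = `|l| * hsum_norm p.
Proof.
rewrite /hsum_norm /= !normrZ !exprMn -mulrDr sqrtrM ?sqr_ge0//.
by rewrite sqrtr_sqr normr_id.
Qed.

Let hsum_normr0_eq0 p : hsum_norm p = 0 -> p = 0.
Proof.
move=> /eqP; rewrite sqrtr_eq0 => h.
have /andP[/eqP h1 /eqP h2] : (`|p.1| ^+ 2 == 0) && (`|p.2| ^+ 2 == 0).
  by rewrite -paddr_eq0 ?sqr_ge0// eq_le h addr_ge0 ?sqr_ge0.
case: p {h} h1 h2 => a b /= /eqP + /eqP.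
by rewrite !sqrf_eq0 !normr_eq0 => /eqP -> /eqP ->.
Qed.

HB.instance Definition _ := @Lmodule_isNormed.Build R (hsum H G)
  hsum_norm hsum_ler_normD hsum_normrZ hsum_normr0_eq0.

Lemma hsum_normE (p : hsum H G) : `|p| = Num.sqrt (`|p.1| ^+ 2 + `|p.2| ^+ 2).
Proof. by []. Qed.

Lemma hsum_norm_le (p : hsum H G) : `|p| <= `|p.1| + `|p.2|.
Proof.
have h : 0 <= `|p.1| + `|p.2| by rewrite addr_ge0.
rewrite hsum_normE -[leRHS]ger0_norm// -sqrtr_sqr ler_sqrt ?sqr_ge0//.
have := normr_ge0 p.1; have := normr_ge0 p.2; nra.
Qed.

Lemma hsum_norm_fst (p : hsum H G) : `|p.1| <= `|p|.
Proof.
rewrite hsum_normE -[leLHS]normr_id -sqrtr_sqr ler_sqrt ?lerDl ?sqr_ge0//.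
Qed.

Lemma hsum_norm_snd (p : hsum H G) : `|p.2| <= `|p|.
Proof.
rewrite hsum_normE -[leLHS]normr_id -sqrtr_sqr ler_sqrt ?lerDr ?sqr_ge0//.
Qed.

Let hsum_cauchy_cvg (F : set_system (hsum H G)) :
  ProperFilter F -> cauchy F -> cvg F.
Proof.
move=> FF /cauchyP Fc.
have F1 : cauchy ((fun p : hsum H G => p.1) @ F).
  apply/cauchyP => e e0; have [p Fp] := Fc _ e0; exists p.1.
  suff : F [set q | ball p.1 e q.1] by [].
  apply: filterS Fp => q; rewrite /= -!ball_normE /=.
  exact: le_lt_trans (hsum_norm_fst (p - q)).
have F2 : cauchy ((fun p : hsum H G => p.2) @ F).
  apply/cauchyP => e e0; have [p Fp] := Fc _ e0; exists p.2.
  suff : F [set q | ball p.2 e q.2] by [].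
  apply: filterS Fp => q; rewrite /= -!ball_normE /=.
  exact: le_lt_trans (hsum_norm_snd (p - q)).
have /cvg_ex[a Fa] : cvg ((fun p : hsum H G => p.1) @ F) by exact: cauchy_cvg.
have /cvg_ex[b Fb] : cvg ((fun p : hsum H G => p.2) @ F) by exact: cauchy_cvg.
apply/cvg_ex; exists ((a, b) : hsum H G).
apply/cvgrPdist_lt => e e0.
have e20 : 0 < e / 2 by rewrite divr_gt0.
move/cvgrPdist_lt/(_ _ e20) : Fa => Fa.
move/cvgrPdist_lt/(_ _ e20) : Fb => Fb.
near=> p; apply: (le_lt_trans (hsum_norm_le _)).
rewrite (splitr e) ltrD//=.
  by near: p; exact: Fa.
by near: p; exact: Fb.
Unshelve. all: by end_near. Qed.

HB.instance Definition _ :=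
  Uniform_isComplete.Build (hsum H G) hsum_cauchy_cvg.

HB.instance Definition _ := CompleteNormedModule_isHilbert.Build R (hsum H G)
  hsum_innerC hsum_innerDl hsum_innerZl (fun p => esym (hsum_sqr_norm p)).

End hilbert_sum.

Section bounded_operators.
Context {R : realType}.
Implicit Types V W : hilbertType R.

Definition self_adjoint V (S : V -> V) : Prop :=
  forall x y, inner (S x) y = inner x (S y).

Definition strongly_monotone V (S : V -> V) : Prop :=
  exists2 m : R, 0 < m & forall x, m * `|x| ^+ 2 <= inner (S x) x.

Definition weighted_sqr_norm V (S : V -> V) (x : V) : R := inner x (S x).

(* Choice-based, so that no existence hypothesis is needed: [adjointP] and
   [inverseK] show that these are the Hilbert adjoint of a bounded operator and
   the two-sided inverse of a bounded self-adjoint strongly monotone one. *)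
Definition adjoint V W (L : V -> W) (v : W) : V :=
  xget 0 [set w | forall x, inner (L x) v = inner x w].

Definition inverse V (S : V -> V) : V -> V := 'pinv_(fun=> 0) setT S.

Lemma coercive_representation V (a : V -> V -> R) (f : V -> R) (m K c : R) :
    (forall x y, a x y = a y x) ->
    (forall x y z, a (x + y) z = a x z + a y z) ->
    (forall t x y, a (t *: x) y = t * a x y) ->
    (forall x y, f (x + y) = f x + f y) ->
    (forall t x, f (t *: x) = t * f x) ->
    0 < m -> (forall x, m * `|x| ^+ 2 <= a x x) ->
    (forall x y, `|a x y| <= K * `|x| * `|y|) ->
    (forall x, `|f x| <= c * `|x|) ->
  exists w, forall h, a w h = f h.
Proof.
move=> aC aDl aZl fD fZ m0 am aK fc.
have aDr x y z : a x (y + z) = a x y + a x z by rewrite aC aDl !(aC x).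
have aZr t x y : a x (t *: y) = t * a x y by rewrite aC aZl aC.
pose J x := a x x - 2 * f x.
have Jlb x : - (c ^+ 2 / m) <= J x.
  have fx : f x <= c * `|x| := le_trans (ler_norm _) (fc x).
  rewrite lerNl -(ler_pM2l m0) mulrCA divff ?gt_eqF// mulr1 /J.
  have := am x; have := sqr_ge0 (m * `|x| - c); have := m0; nra.
have Jinf : has_inf (range J).
  by split; [exists (J 0); exists 0|exists (- (c ^+ 2 / m)) => _ [x _ <-]].
set I := inf (range J).
have IJ x : I <= J x by apply: ge_inf; [exact: Jinf.2|exists x].
have /choice[u Ju] n : exists x, J x < I + n.+1%:R^-1.
  have [|_ [x _ <-] h] := @inf_adherent _ (range J) n.+1%:R^-1 _ Jinf.
    by rewrite invr_gt0.
  by exists x.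
have near_min n h : (a (u n) h - f h) ^+ 2 <= a h h * n.+1%:R^-1.
  have [->|h0] := eqVneq h 0.
    have -> : a (u n) 0 = 0 by rewrite -(scale0r 0) aZr mul0r.
    have -> : f 0 = 0 by rewrite -(scale0r 0) fZ mul0r.
    have -> : a 0 0 = 0 by rewrite -(scale0r 0) aZr mul0r.
    by rewrite subr0 expr0n mul0r.
  have ahh : 0 < a h h.
    by apply: lt_le_trans (am h); rewrite mulr_gt0// exprn_gt0// normr_gt0.
  set d := a (u n) h - f h; set A := a h h; set t := - (d / A).
  have : I <= J (u n + t *: h) by [].
  have -> : J (u n + t *: h) = J (u n) + 2 * t * d + t ^+ 2 * A.
    rewrite /J !(aDl, aDr, aZl, aZr, fD, fZ) (aC h) -/A.
    by rewrite -[a (u n) h](subrK (f h)) -/d; ring.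
  have -> : J (u n) + 2 * t * d + t ^+ 2 * A = J (u n) - d ^+ 2 / A.
    by rewrite /t; field; rewrite gt_eqF.
  rewrite -ler_pdivrMl// (mulrC A^-1); have := Ju n.
  by move: (J (u n)) (d ^+ 2 / A) (n.+1%:R^-1) => j q e; lra.
have parallelogram n k :
    m * `|u n - u k| ^+ 2 <= 2 * (n.+1%:R^-1 + k.+1%:R^-1).
  apply: le_trans (am _) _.
  have := IJ (2^-1 *: (u n + u k)); have := Ju n; have := Ju k.
  rewrite /J -[- u k]scaleN1r !(aDl, aDr, aZl, aZr, fD, fZ) (aC (u k) (u n)).
  by move: (n.+1%:R^-1) (k.+1%:R^-1) => e e'; lra.
have small (e : R) : 0 < e -> \forall n \near \oo, (n.+1%:R : R)^-1 < e.
  move=> e0; have /cvgrPdist_lt/(_ _ e0) := @cvg_harmonic R.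
  apply: filterS => n /=; rewrite sub0r normrN ger0_norm// harmonic_ge0.
have : cauchy (u @ \oo).
  apply: cauchy_exP => e e0.
  have d0 : 0 < m * e ^+ 2 / 4 by rewrite divr_gt0// mulr_gt0// exprn_gt0.
  have [n hn] := filter_ex (small _ d0).
  exists (u n); suff : \forall k \near \oo, ball (u n) e (u k) by [].
  apply: filterS (small _ d0) => k hk; rewrite -ball_normE /=.
  rewrite -(@ltr_pXn2r _ 2)// ?nnegrE// ?(ltW e0)// -(ltr_pM2l m0).
  apply: le_lt_trans (parallelogram n k) _.
  by move: (n.+1%:R^-1) (k.+1%:R^-1) hn hk => x y; lra.
move=> /cauchy_cvg/cvg_ex[w uw]; exists w => h.
have c1 : a (u n) h @[n --> \oo] --> a w h.
  apply/cvgrPdist_lt => e e0; set M := `|K| * `|h| + 1.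
  have M0 : 0 < M by rewrite ltr_wpDl// mulr_ge0.
  have eM : 0 < e / M by rewrite divr_gt0.
  move/cvgrPdist_lt/(_ _ eM) : uw; apply: filterS => n.
  rewrite ltr_pdivlMr// => hn.
  have -> : a w h - a (u n) h = a (w - u n) h.
    by rewrite -[- u n]scaleN1r aDl aZl mulN1r.
  apply: le_lt_trans (aK _ _) _; apply: le_lt_trans hn.
  rewrite /M mulrDr mulr1 mulrAC mulrC ler_wpDr// ler_wpM2l//.
  by rewrite ler_wpM2r// ler_norm.
have c2 : a (u n) h @[n --> \oo] --> f h.
  apply/cvgrPdist_lt => e e0; set M := a h h + 1.
  have M0 : 0 < M.
    rewrite ltr_wpDl//; apply: le_trans (am h).
    by rewrite mulr_ge0 ?sqr_ge0// ltW.
  have eM : 0 < e ^+ 2 / M by rewrite divr_gt0// exprn_gt0.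
  apply: filterS (small _ eM) => n; rewrite ltr_pdivlMr// => hn.
  rewrite distrC -(@ltr_pXn2r _ 2)// ?nnegrE// ?(ltW e0)//.
  rewrite -normrX ger0_norm ?sqr_ge0//.
  apply: le_lt_trans (near_min n h) _; apply: le_lt_trans hn.
  by rewrite /M mulrDr mulr1 mulrC lerDl invr_ge0.
exact: cvg_unique c1 c2.
Qed.

Lemma bounded_linear_norm V W (L : {linear V -> W}) :
  bounded_near L (nbhs 0) -> exists2 k, 0 <= k & forall x, `|L x| <= k * `|x|.
Proof.
move=> /linear_boundedP/pinfty_ex_gt0[k k0 Lk].
by exists k => //; exact: ltW.
Qed.

Lemma adjointP V W (L : {linear V -> W}) : bounded_near L (nbhs 0) ->
  forall x v, inner (L x) v = inner x (adjoint L v).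
Proof.
move=> /bounded_linear_norm[k k0 Lk] x v.
suff [w wP] : exists w, forall y, inner w y = inner (L y) v.
  apply: (xgetPex 0 (P := [set w | forall x, inner (L x) v = inner x w])).
  by exists w => y; rewrite (innerC y) wP.
apply: (@coercive_representation V inner _ 1 1 (k * `|v|)).
- exact: innerC.
- exact: innerDl.
- exact: innerZl.
- by move=> y z; rewrite linearD innerDl.
- by move=> t y; rewrite linearZ innerZl.
- exact: ltr01.
- by move=> y; rewrite mul1r inner_norm.
- by move=> y z; rewrite mul1r inner_CauchySchwarz.
- move=> y; apply: le_trans (inner_CauchySchwarz _ _) _.
  by rewrite mulrAC ler_wpM2r.
Qed.

Lemma inverseK V (S : {linear V -> V}) :
  bounded_near S (nbhs 0) -> self_adjoint S -> strongly_monotone S ->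
  cancel S (inverse S) /\ cancel (inverse S) S.
Proof.
move=> /bounded_linear_norm[k k0 Sk] Ssa [m m0 Sm].
have Sinj : injective S.
  move=> x y xy; apply/eqP; rewrite -subr_eq0 -normr_le0.
  have := Sm (x - y); rewrite linearB xy subrr.
  have -> : inner 0 (x - y) = 0 by rewrite -(scale0r 0) innerZl mul0r.
  rewrite pmulr_rle0// => h; have := sqr_ge0 `|x - y|; have := normr_ge0 (x - y).
  by move: h; nra.
have Ssurj y : exists x, S x = y.
  have [|||||||||x xP] := @coercive_representation V
    (fun x z => inner (S x) z) (inner y) m k `|y|.
  - by move=> x z; rewrite Ssa innerC.
  - by move=> x z t; rewrite linearD innerDl.
  - by move=> t x z; rewrite linearZ innerZl.
  - by move=> x z; rewrite innerDr.
  - by move=> t x; rewrite innerZr.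
  - exact: m0.
  - exact: Sm.
  - move=> x z; apply: le_trans (inner_CauchySchwarz _ _) _.
    by rewrite ler_wpM2r.
  - by move=> x; exact: inner_CauchySchwarz.
  exists x; apply/eqP; rewrite -subr_eq0 -normr_le0.
  rewrite -(@ler_pXn2r _ 2)// ?nnegrE// expr0n /=.
  by rewrite -inner_norm innerBl xP subrr.
split.
- by move=> x; rewrite /inverse pinvKV// ?inE// => ? ? _ _; exact: Sinj.
- by move=> y; rewrite /inverse pinvK// inE; have [x] := Ssurj y; exists x.
Qed.

End bounded_operators.

Section set_valued.
Context {R : realType}.
Implicit Types V W : hilbertType R.

Definition gra V W (E : V -> set W) : set (V * W) := [set p | E p.1 p.2].

Definition zer V (E : V -> set V) : set V := [set x | E x 0].

Definition op_fun V W (f : V -> W) : V -> set W := fun x => [set f x].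

Definition op_add V W (E F : V -> set W) : V -> set W :=
  fun x => [set u + v | u in E x & v in F x].

Definition op_scale V W (t : R) (E : V -> set W) : V -> set W :=
  fun x => [set t *: u | u in E x].

Definition op_inv V W (E : V -> set W) : W -> set V :=
  fun u => [set x | E x u].

Definition resolvent V (E : V -> set V) : V -> set V :=
  op_inv (op_add (op_fun idfun) E).

Definition single_valued_full_domain V W (E : V -> set W) : Prop :=
  forall x, exists! y, E x y.

Definition semimonotone V (M N : V -> V) (E : V -> set V) (S : set (V * V)) :
    Prop :=
  forall x u y v, gra E (x, u) -> S (y, v) ->
    inner (x - y) (M (x - y)) + inner (u - v) (N (u - v)) <=
      inner (x - y) (u - v).

Definition weak_cvg V (x : nat -> V) (l : V) : Prop :=
  forall y, inner (x n) y @[n --> \oo] --> inner l y.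

Definition seq_weak_strong_closed V W (S : set (V * W)) : Prop :=
  forall (x : nat -> V) (u : nat -> W) (lx : V) (lu : W),
    weak_cvg x lx -> u @ \oo --> lu -> (forall n, S (x n, u n)) -> S (lx, lu).

Definition cocoercive V (b : R) (C : V -> V) : Prop :=
  forall x y, b * `|C x - C y| ^+ 2 <= inner (x - y) (C x - C y).

End set_valued.

Section primal_dual.
Context {R : realType} {H G : hilbertType R}.
Variables (L : H -> G) (A : H -> set H) (B : G -> set G) (C D : H -> H).

Definition solutions : set (hsum H G) :=
  [set p | [set w + adjoint L p.2
             | w in op_add (op_add A (op_fun C)) (op_fun D) p.1] 0
           /\ B (L p.1) p.2].

Definition pd_A : hsum H G -> set (hsum H G) := fun p =>
  [set w + adjoint L p.2 | w in op_add A (op_fun D) p.1] `*`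
  [set x - L p.1 | x in op_inv B p.2].

Definition pd_C : hsum H G -> hsum H G := fun p => (C p.1, 0).

Definition pd_S : set (hsum H G * hsum H G) :=
  [set (p, - pd_C p) | p in zer (op_add pd_A (op_fun pd_C))].

End primal_dual.

Definition parallel_sum {R : realType} (a b : R) : R := a * b / (a + b).

Definition mu_hat {R : realType} (tau sigma nuA nuB : R) : R :=
  Num.min nuA (sigma * nuB / tau).

Definition rho_hat {R : realType} (tau sigma muA muB rhoA rhoB : R) : R :=
  if 0 < Num.min (rhoA + rhoB) (muA + muB) then
    Num.min 0 (Num.min (parallel_sum rhoA rhoB)
                       (tau / sigma * parallel_sum muA muB))
  else if [&& rhoA == 0, rhoB == 0 & 0 < muA + muB] then
    Num.min 0 (tau / sigma * parallel_sum muA muB)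
  else if [&& muA == 0, muB == 0 & 0 < rhoA + rhoB] then
    Num.min 0 (parallel_sum rhoA rhoB)
  else 0.

(* Main.v *)
Require Import Defs.
From mathcomp Require Import all_boot all_order all_algebra.
From mathcomp Require Import all_classical all_reals all_analysis.
From mathcomp Require Import ring lra.

Set Implicit Arguments.
Unset Strict Implicit.
Unset Printing Implicit Defensive.

Import Order.TTheory GRing.Theory Num.Theory.
Import numFieldNormedType.Exports.

Local Open Scope classical_set_scope.
Local Open Scope ring_scope.

(* For (z, v) with images a in (A + D) z, v in B y, and a solution (x, u), the
   skew terms L^* and -L cancel, so the left-hand pairing equals
   <z - x, a'> + <v - u, y'> with a' = a + C x + L^* u and y' = y - L x.  The
   two semimonotonicity hypotheses bound it below by
     nuA |z - x|^2 + nuB |v - u|^2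
       + (rhoA |a'|^2 + rhoB |L^* (v - u)|^2)
       + (muA |L (z - x)|^2 + muB |y'|^2).
   The components of the difference of images are a' + L^* (v - u) and
   y' - L (z - x), so each bracket is at least the parallel sum of its
   coefficients times the square of a component.  The bounds on S and its
   inverse then conclude, as mu_hat >= 0 and rho_hat <= 0. *)

Lemma innerNl (R : realType) (V : hilbertType R) (x y : V) :
  inner (- x) y = - inner x y.
Proof. by rewrite -scaleN1r innerZl mulN1r. Qed.

Lemma innerBr (R : realType) (V : hilbertType R) (x y z : V) :
  inner x (y - z) = inner x y - inner x z.
Proof. by rewrite innerC innerBl !(innerC x). Qed.

(** [adjoint] is defined by choice, so additivity has to come from its characteristic identity:
    [adjointP] makes the defect orthogonal to itself. *)
Lemma adjointB (R : realType) (V W : hilbertType R) (L : {linear V -> W})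
    (v w : W) : bounded_near L (nbhs (0 : V)) ->
  adjoint L (v - w) = adjoint L v - adjoint L w.
Proof.
move=> Lb; apply/eqP; rewrite -subr_eq0 -normr_eq0 -sqrf_eq0 -inner_norm.
by rewrite !(innerBr (_ - _)) -!adjointP// innerBr subrr.
Qed.

(** Multiplied by [a + b], the gap between the two sides is exactly [|a x - b y|^2]; either
    coefficient may be negative. *)
Lemma parallel_sum_le (R : realType) (V : hilbertType R) (a b : R) (x y : V) :
  0 < a + b ->
  parallel_sum a b * `|x + y| ^+ 2 <= a * `|x| ^+ 2 + b * `|y| ^+ 2.
Proof.
move=> ab0; rewrite /parallel_sum mulrAC ler_pdivrMr// -!inner_norm.
have : 0 <= inner (a *: x - b *: y) (a *: x - b *: y).
  by rewrite (inner_norm (a *: x - b *: y)) sqr_ge0.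
rewrite !(innerBl, innerBr, innerDl, innerDr, innerZl, innerZr) (innerC y x).
by move: (inner x x) (inner x y) (inner y y) => p q r; nra.
Qed.

(** Treats the degenerate case along with the regular one: when [a + b = 0] the right-hand side
    vanishes and [c <= 0] suffices. *)
Lemma le_parallel_sum_bound (R : realType) (V : hilbertType R) (a b c : R)
    (x y : V) :
  c <= 0 -> 0 <= a + b -> (a + b = 0 -> a = 0 /\ b = 0) ->
  (0 < a + b -> c <= parallel_sum a b) ->
  c * `|x + y| ^+ 2 <= a * `|x| ^+ 2 + b * `|y| ^+ 2.
Proof.
move=> c0; rewrite le_eqVlt => /predU1P[/esym ab0 /(_ ab0)[-> ->] _|ab0 _ h].
  by rewrite !mul0r addr0 mulr_le0_ge0 ?sqr_ge0.
apply: le_trans (parallel_sum_le x y ab0).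
by rewrite ler_wpM2r ?sqr_ge0 ?h.
Qed.

(** The factor [tau / sigma] is the weight of the second component in the bound on [S]. *)
Lemma mu_hat_bounds (R : realType) (tau sigma nuA nuB : R) :
  0 < tau -> 0 < sigma -> 0 <= nuA -> 0 <= nuB ->
  [/\ 0 <= mu_hat tau sigma nuA nuB, mu_hat tau sigma nuA nuB <= nuA &
      mu_hat tau sigma nuA nuB * (tau / sigma) <= nuB].
Proof.
move=> t0 s0 a0 b0; rewrite /mu_hat; split.
- by rewrite le_min a0 divr_ge0 ?mulr_ge0 // ltW.
- by rewrite ge_min lexx.
- rewrite -ler_pdivlMr ?divr_gt0// invf_div (mulrCA nuB) (mulrA sigma).
  by rewrite ge_min lexx orbT.
Qed.

(** Condenses the four-case definition into the premises of [le_parallel_sum_bound]; [sigma / tau]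
    is the weight in the bound on [inverse S]. *)
Lemma rho_hat_bounds (R : realType) (tau sigma muA muB rhoA rhoB : R) :
  0 < tau -> 0 < sigma -> 0 <= rhoA + rhoB -> 0 <= muA + muB ->
  (rhoA + rhoB = 0 -> rhoA = 0 /\ rhoB = 0) ->
  (muA + muB = 0 -> muA = 0 /\ muB = 0) ->
  let r := rho_hat tau sigma muA muB rhoA rhoB in
  [/\ r <= 0, 0 < rhoA + rhoB -> r <= parallel_sum rhoA rhoB &
      0 < muA + muB -> r * (sigma / tau) <= parallel_sum muA muB].
Proof.
move=> t0 s0 rho0 mu0 rhoE muE r.
have mulE (x : R) : (x * (sigma / tau) <= parallel_sum muA muB) =
    (x <= tau / sigma * parallel_sum muA muB).
  by rewrite -ler_pdivlMr ?divr_gt0// invf_div mulrC.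
rewrite mulE /r /rho_hat lt_min.
have [_|rho_le0] := ltP 0 (rhoA + rhoB); last first.
  have /rhoE[-> ->] : rhoA + rhoB = 0 by apply/le_anti/andP.
  by rewrite !eqxx /=; case: ifP => _; rewrite ?andbF ?ge_min ?lexx ?orbT.
have [_|mu_le0] := ltP 0 (muA + muB).
  by rewrite !ge_min !lexx !orbT.
have /muE[-> ->] : muA + muB = 0 by apply/le_anti/andP.
by rewrite !andbF !eqxx /= !ge_min !lexx !orbT.
Qed.

(** Links [pd_S], built from zeros, to the semimonotonicity hypotheses, stated on [solutions]. *)
Lemma zer_pd_solutions (R : realType) (H G : hilbertType R)
    (L : H -> G) (A : H -> set H) (B : G -> set G) (C D : H -> H)
    (p : hsum H G) :
  zer (op_add (pd_A L A B D) (op_fun (pd_C C))) p -> solutions L A B C D p.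
Proof.
move=> [[q1 q2] [[w [a Aa [_ -> <-]] /= <-] [y By /= <-]] [_ ->]].
move=> /[dup] /(congr1 fst) /= e1 /(congr1 snd) /= e2; split.
  exists (a + C p.1 + D p.1).
    by exists (a + C p.1); [exists a => //; exists (C p.1)|exists (D p.1)].
  by rewrite -e1 (addrAC a) (addrAC _ (C p.1)).
by move: e2 By; rewrite addr0 => /eqP; rewrite subr_eq0 => /eqP ->.
Qed.

Theorem proposition4p6 (R : realType) (H G : hilbertType R)
  (L : {linear H -> G}) (A : H -> set H) (B : G -> set G) (C D : H -> H)
  (beta theta : R)
  (L_bounded : bounded_near L (nbhs (0 : H)))
  (beta_gt0 : 0 < beta) (C_cocoercive : cocoercive beta C)
  (theta_ge0 : 0 <= theta) (D_lipschitz : theta.-lipschitz D)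
  (Z_nonempty : solutions L A B C D !=set0)
  (muA muB rhoA rhoB nuA nuB : R)
  (nuA_ge0 : 0 <= nuA) (nuB_ge0 : 0 <= nuB)
  (rho_ge0 : 0 <= rhoA + rhoB) (mu_ge0 : 0 <= muA + muB)
  (rho_eq0 : rhoA + rhoB = 0 -> rhoA = 0 /\ rhoB = 0)
  (mu_eq0 : muA + muB = 0 -> muA = 0 /\ muB = 0)
  (AD_semimonotone :
    semimonotone (fun x => nuA *: x + muA *: adjoint L (L x))
                 (fun x => rhoA *: x)
                 (op_add A (op_fun D))
                 [set (p.1, - C p.1 - adjoint L p.2)
                   | p in solutions L A B C D])
  (B_semimonotone :
    semimonotone (fun y => muB *: y)
                 (fun y => nuB *: y + rhoB *: L (adjoint L y))
                 B
                 [set (L p.1, p.2) | p in solutions L A B C D])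
  (resolvents : exists OmegaA OmegaB : set R,
    [/\ OmegaA !=set0, OmegaB !=set0,
        OmegaA `<=` [set t | 0 < t], OmegaB `<=` [set t | 0 < t] &
        forall t s, OmegaA t -> OmegaB s ->
          single_valued_full_domain (resolvent (op_scale t A)) /\
          single_valued_full_domain (resolvent (op_scale s (op_inv B)))])
  (graph_closed : seq_weak_strong_closed
    (gra (op_add (pd_A L A B D) (op_fun (@pd_C R H G C)))))
  (tau sigma : R) (tau_gt0 : 0 < tau) (sigma_gt0 : 0 < sigma)
  (S : {linear hsum H G -> hsum H G})
  (S_bounded : bounded_near S (nbhs (0 : hsum H G)))
  (S_self_adjoint : self_adjoint S)
  (S_strongly_monotone : strongly_monotone S)
  (chi_lo chi_up : R) (chi_lo_gt0 : 0 < chi_lo) (chi_up_gt0 : 0 < chi_up)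
  (S_bound : forall (z : H) (v : G),
    chi_lo * weighted_sqr_norm S ((z, v) : hsum H G)
      <= `|z| ^+ 2 + tau / sigma * `|v| ^+ 2)
  (S_inv_bound : forall (z : H) (v : G),
    `|z| ^+ 2 + sigma / tau * `|v| ^+ 2
      <= chi_up * weighted_sqr_norm (inverse S) ((z, v) : hsum H G)) :
  semimonotone
    (fun p => (chi_lo * mu_hat tau sigma nuA nuB) *: S p)
    (fun p => (chi_up * rho_hat tau sigma muA muB rhoA rhoB) *: inverse S p)
    (pd_A L A B D)
    (pd_S L A B C D).
Proof.
move=> [z v] [b1 b2] [x u] c [/= [a Aa <-] [y By <-]].
move=> [q Zq [qE <-]] {c}; rewrite {q}qE in Zq *.
have Zp := zer_pd_solutions Zq.
set da := a + C x + adjoint L u; set dy := y - L x.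
have hA : nuA * `|z - x| ^+ 2 + muA * `|L (z - x)| ^+ 2 + rhoA * `|da| ^+ 2
    <= inner (z - x) da.
  have := AD_semimonotone z a x _ Aa (imageP _ Zp).
  have -> : a - (- C x - adjoint L u) = da by rewrite opprB opprK addrA addrAC.
  by rewrite innerDr !innerZr -(adjointP L_bounded) !inner_norm.
have hB : muB * `|dy| ^+ 2 +
    (nuB * `|v - u| ^+ 2 + rhoB * `|adjoint L (v - u)| ^+ 2)
    <= inner dy (v - u).
  have := B_semimonotone y v (L x) u By (imageP _ Zp); rewrite /= -/dy.
  rewrite (innerDr (nuB *: _)) !innerZr.
  rewrite (innerC (v - u) (L _)) (adjointP L_bounded).
  by rewrite !inner_norm.
pose p : hsum H G := (z - x, v - u).
(* Both components are written as sums, the shape [le_parallel_sum_bound] expects. *)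
pose q : hsum H G := (da + adjoint L (v - u), dy + - L (z - x)).
have -> : ((z, v) : hsum H G) - (x, u) = p by [].
have -> : ((a + adjoint L v, y - L z) : hsum H G) - - pd_C C (x, u) = q.
  rewrite opprK /q; congr pair.
    by rewrite /= adjointB// [RHS]addrACA addrN addr0 addrAC.
  by rewrite /= addr0 linearB opprB addrA subrK.
rewrite !innerZr.
have -> : inner p q = inner (z - x) da + inner dy (v - u).
  rewrite -[LHS]/(inner (z - x) (da + adjoint L (v - u)) +
                  inner (v - u) (dy + - L (z - x))).
  rewrite (innerDr da) (innerDr dy) -(adjointP L_bounded).
  rewrite (innerC _ dy) (innerC _ (- _)).
  by rewrite innerNl; ring.
have [mu0 muA_le muB_le] := mu_hat_bounds tau_gt0 sigma_gt0 nuA_ge0 nuB_ge0.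
have [r0 r_rho r_mu] :=
  rho_hat_bounds tau_gt0 sigma_gt0 rho_ge0 mu_ge0 rho_eq0 mu_eq0.
have hp : chi_lo * mu_hat tau sigma nuA nuB * inner p (S p)
    <= nuA * `|z - x| ^+ 2 + nuB * `|v - u| ^+ 2.
  rewrite mulrAC mulrC.
  apply: le_trans (ler_wpM2l mu0 (S_bound (z - x) (v - u))) _.
  by rewrite mulrDr (mulrA _ (tau / _)) lerD// ler_wpM2r ?sqr_ge0.
have hq : chi_up * rho_hat tau sigma muA muB rhoA rhoB * inner q (inverse S q)
    <= rhoA * `|da| ^+ 2 + rhoB * `|adjoint L (v - u)| ^+ 2
       + (muA * `|L (z - x)| ^+ 2 + muB * `|dy| ^+ 2).
  rewrite mulrAC mulrC.
  (* Multiplying by the nonpositive [rho_hat] reverses the bound on [inverse S]. *)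
  apply: le_trans (ler_wnM2l r0 (S_inv_bound q.1 q.2)) _.
  rewrite mulrDr (mulrA _ (sigma / _)) lerD//.
    exact: le_parallel_sum_bound.
  (* The summands are [- L (z - x)] and [dy], in the order of [muA] and [muB]. *)
  rewrite -[`|L _|]normrN [q.2]addrC le_parallel_sum_bound//.
  by rewrite mulr_le0_ge0 ?divr_ge0// ltW.
(* The right-hand sides of [hp] and [hq] add up to the left-hand sides of [hA] and [hB]. *)
lra.
Qed.
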